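(* For every compact linearly ordered topological space (LOTS) $X$ we have $dis(X) \geq \Delta(X)$.
   Context: A LOTS is a linearly ordered set endowed with the order topology. $dis(X)$ denotes the least number of discrete sets required to cover $X$ (a subset of $X$ is discrete if its subspace topology is discrete; it need not be closed in $X$). $\Delta(X)$ denotes the least cardinality of a nonempty open subset of $X$ (for nonempty $X$). *)

(* Defs.v *)
From HB Require Import structures.
From mathcomp Require Import all_boot all_order all_algebra.
From mathcomp Require Import all_classical topology.

Set Implicit Arguments.
Unset Strict Implicit.
Unset Printing Implicit Defensive.

Local Open Scope classical_set_scope.
Local Open Scope card_scope.

(* A cardinal is represented by a set of that cardinality: [least_card P] is
   some member of [P] whose cardinality is least among the members of [P].
   The default [set0] is irrelevant for nonempty [P], by [least_cardP]. *)
Definition least_card (T : Type) (P : set (set T)) : set T :=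
  xget set0 [set A | P A /\ forall B, P B -> A #<= B].

Lemma least_card_ex (T : Type) (P : set (set T)) : P !=set0 ->
  exists A, P A /\ forall B, P B -> A #<= B.
Proof.
move=> [A0 PA0]; have [P0|P0] := pselect (P set0).
  by exists set0; split => // B _; exact: card_ge0.
have neP A : P A -> A !=set0.
  by move=> PA; apply/set0P/eqP => A_0; rewrite A_0 in PA.
(* a maximal set of choice functions that are pairwise distinct everywhere *)
pose Q (S : set (set T -> T)) :=
  (forall f A, S f -> P A -> A (f A)) /\
  (forall f g A, S f -> S g -> P A -> f A = g A -> f = g).
have [|S [[Sin Sinj] Smax]] := @Zorn_bigcup _ Q.
  move=> F FQ Ftot; split.
    by move=> f A [S FS Sf]; have [+ _] := FQ _ FS; apply.
  move=> f g A [S FS Sf] [S' FS' S'g].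
  have [SS'|S'S] := Ftot _ _ FS FS'.
    by have [_ +] := FQ _ FS'; apply => //; exact: SS'.
  by have [_ +] := FQ _ FS; apply => //; exact: S'S.
have [A [PA AS]] : exists A, P A /\ A `<=` (fun f => f A) @` S.
  apply: contrapT => /forallNP noA.
  have ex A : exists x, P A -> A x /\ ~ ((fun f => f A) @` S) x.
    have [PA|nPA] := pselect (P A); last by have [x _] := neP _ PA0; exists x.
    have : ~ (A `<=` (fun f => f A) @` S) by move=> AS; apply: (noA A).
    by move=> /existsNP[x /not_implyP[Ax nx]]; exists x.
  have [h hP] := choice ex.
  apply: (Smax (S `|` [set h])).
    split; first by move=> f; left.
    move=> SS; have Sh : S h by apply: SS; right.
    by have [_] := hP _ PA0; apply; exists h.
  split.
    by move=> f A [Sf|->] PA; [exact: (Sin _ _ Sf PA)|have [] := hP _ PA].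
  move=> f g A [Sf|->] [Sg|->] PA //.
  - exact: (Sinj _ _ _ Sf Sg PA).
  - by move=> fh; have [_ []] := hP _ PA; exists f.
  - by move=> hg; have [_ []] := hP _ PA; exists g.
exists A; split => // B PB.
apply: card_le_trans (subset_card_le AS) _.
apply: card_le_trans (card_image_le _ _) _.
have /injfunPex[f] : exists2 f : (set T -> T) -> T, set_fun S B f & set_inj S f.
  exists (fun f => f B); first by move=> f Sf; exact: (Sin _ _ Sf PB).
  by move=> f g /set_mem Sf /set_mem Sg; exact: (Sinj _ _ _ Sf Sg PB).
exact: inj_card_le.
Qed.

Lemma least_cardP (T : Type) (P : set (set T)) : P !=set0 ->
  P (least_card P) /\ forall B, P B -> least_card P #<= B.
Proof.
move=> /least_card_ex[A PA].
exact: (@xgetI _ set0 [set A | P A /\ forall B, P B -> A #<= B] A PA).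
Qed.

(* [initial_topology] along the inclusion of the subtype [A] is the subspace
   topology. *)
Definition discrete_subset (X : topologicalType) (A : set X) : Prop :=
  forall B : set (initial_topology (val : A -> X)), open B.

Definition dis (X : topologicalType) : set (set X) :=
  least_card [set F : set (set X) |
    (forall A, F A -> discrete_subset A) /\ \bigcup_(A in F) A = [set: X]].
Arguments dis : clear implicits.

Definition Delta (X : topologicalType) : set X :=
  least_card [set U : set X | open U /\ U !=set0].
Arguments Delta : clear implicits.

Lemma disP (X : topologicalType) :
  [/\ forall A, dis X A -> discrete_subset A, \bigcup_(A in dis X) A = [set: X]
    & forall F : set (set X), (forall A, F A -> discrete_subset A) ->
        \bigcup_(A in F) A = [set: X] -> dis X #<= F].
Proof.
have [|[dX cX] mX] := @least_cardP _ [set F : set (set X) |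
    (forall A, F A -> discrete_subset A) /\ \bigcup_(A in F) A = [set: X]].
  exists [set [set x] | x in [set: X]]; split; last first.
    by apply/seteqP; split => // x _; exists [set x] => //; exists x.
  move=> _ [x _ <-] B; have [Bx|Bx] := pselect (exists y, B y); last first.
    suff -> : B = set0 by exact: open0.
    by apply/seteqP; split => // y By; apply: Bx; exists y.
  suff -> : B = [set: initial_topology val] by exact: openT.
  apply/seteqP; split => // y _; have [z Bz] := Bx.
  suff -> : y = z by [].
  by apply: val_inj; rewrite /= (set_mem (valP y)) (set_mem (valP z)).
by split => // F dF cF; exact: mX.
Qed.

Lemma DeltaP (X : topologicalType) : [set: X] !=set0 ->
  [/\ open (Delta X), Delta X !=set0
    & forall U : set X, open U -> U !=set0 -> Delta X #<= U].
Proof.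
move=> X0; have [|[oX nX] mX] := @least_cardP _
    [set U : set X | open U /\ U !=set0].
  by exists [set: X]; split => //; exact: openT.
by split => // U oU nU; exact: mX.
Qed.

(* Main.v *)
Require Import Defs.
From mathcomp Require Import all_boot all_order all_algebra.
From mathcomp Require Import all_classical topology.

(** If [X] has an isolated point then [Delta X] has at most one element, whereas
    a cover of [X] has at least one member. Otherwise let [K] be a family of discrete sets
    that covers [X]; some nonempty open set has cardinality at most that of [K]
    ([small_open_of_discrete_cover]). For a point [a], consider the first
    points, from [a] on, of the members of [K]; there are at most as many as
    there are members of [K].

    The first points from [a] on are dense in [ ]a, b[ ] for some nonempty
    interval [ ]a, b[ ] ([first_points_dense_itv]). Otherwise nonempty
    intervals [ ]a n, b n[ ] can be chosen so that [a n] strictly increases,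
    [b n] decreases, and [ [a n.+1, b n.+1] ] misses the first points from
    [a n] on. By compactness the points [a n] accumulate at some [x], which
    lies in all the intervals. It belongs to some [B] in [K], and since [B] is
    discrete, for some [n] the only point of [B] in [ [a n, x] ] is [x]. Then
    [x] is the first point of [B] from [a n] on, although it lies in
    [ [a n.+1, b n.+1] ].

    Let [E] be the set of first points from such an [a] on. Each point [x] of
    [ ]a, b[ ] lies in some [B] in [K], and is isolated from the rest of [B] by
    an interval. That interval contains some [e] in [E] other than [x], by
    density. Hence [x] is the first point of [B] after [e], or the last one
    before [e], and is determined by [e], [B] and the side of [e]
    ([open_sub_first_points]). So [ ]a, b[ ] has at most [2 * |K| * |K|]
    points. Being infinite, it forces [K] to be infinite, and [|K| * |K|] is
    then [|K|] ([card_square]). *)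

Import Order.TTheory.

Local Open Scope classical_set_scope.
Local Open Scope card_scope.

(** * Squares of infinite cardinals *)

(** Relations replace functions because no function from [T] to [U] need exist
    when [A] is empty, and because in the comparisons below the image of a point
    is only asserted to exist. *)
Lemma card_le_relP {T U : Type} {A : set T} {B : set U} :
  A #<= B <-> exists R : T -> U -> Prop,
    (forall x, A x -> exists2 y, B y & R x y) /\
    (forall x x' y, A x -> A x' -> R x y -> R x' y -> x = x').
Proof.
split=> [/card_leP[f]|[R [Rtot Rinj]]].
  exists (fun x y => exists a : A, x = val a /\ y = val (f a)); split.
    move=> x Ax; pose a : A := SigSub (mem_set Ax).
    by exists (val (f a)); [exact: set_valP|exists a].
  move=> x x' y _ _ [a [-> ->]] [a' [-> /val_inj faa']].
  by congr val; apply: (@inj _ _ [set: A] f); rewrite ?inE.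
have ex (a : A) : exists b : B, R (val a) (val b).
  have [y By Ray] := Rtot _ (set_valP a).
  by exists (SigSub (mem_set By)).
have [f fP] := choice ex.
apply/card_leP/injfunPex; exists f => // a a' _ _ faa'.
apply: val_inj; apply: (Rinj _ _ (val (f a))); [exact: set_valP..|exact: fP|].
by rewrite faa'; exact: fP.
Qed.

Lemma card_leX {T U V W : Type} {A : set T} {B : set U} {C : set V} {D : set W} :
  A #<= C -> B #<= D -> A `*` B #<= C `*` D.
Proof.
move=> /card_le_relP[R [Rtot Rinj]] /card_le_relP[S [Stot Sinj]].
apply/card_le_relP.
exists (fun p q => R p.1 q.1 /\ S p.2 q.2); split.
  move=> [x y] [/= /Rtot[u Cu xu] /Stot[v Dv yv]].
  by exists (u, v).
move=> [x y] [x' y'] [u v] /= [Ax By] [Ax' By'] [xu yv] [x'u y'v].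
by rewrite (Rinj x x' u) // (Sinj y y' v).
Qed.

(** The two halves are told apart by tagging them with two distinct elements. *)
Lemma card_leU {T U : Type} {A B : set T} {D : set U} :
  infinite_set D -> D `*` D #<= D ->
  A #<= D -> B #<= D -> A `|` B #<= D.
Proof.
move=> Dinf DD /card_le_relP[R [Rtot Rinj]] /card_le_relP[S [Stot Sinj]].
have [d Dd] := infinite_setN0 Dinf.
have [e [De ed]] : exists e, D e /\ e <> d.
  apply: contrapT => /forallNP noe; apply: Dinf.
  apply: sub_finite_set (finite_set1 d) => e De /=.
  by apply: contrapT => ed; apply: (noe e).
apply: card_le_trans DD; apply/card_le_relP.
exists (fun x q => (A x /\ R x q.1 /\ q.2 = d) \/
                   (~ A x /\ S x q.1 /\ q.2 = e)); split.
  move=> x ABx; have [Ax|nAx] := pselect (A x).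
    by have [u Du xu] := Rtot _ Ax; exists (u, d); [split|left].
  case: ABx => // /Stot[u Du xu].
  by exists (u, e); [split|right].
move=> x x' [u t] ABx ABx' /= [[Ax [xu ->]]|[nAx [xu ->]]].
  by move=> [[Ax' [x'u _]]|[_ [_ /esym]]] //; exact: Rinj xu x'u.
move=> [[_ [_]]|[nAx' [x'u _]]] //.
case: ABx ABx' => // Bx [] // Bx'; exact: Sinj xu x'u.
Qed.

Lemma card_le_total {T : Type} (A B : set T) : A #<= B \/ B #<= A.
Proof.
have [|PC mC] := @least_cardP _ [set C : set T | C = A \/ C = B].
  by exists A; left.
have lA := mC A (or_introl erefl); have lB := mC B (or_intror erefl).
by move: PC lA lB => [] -> lA lB; [left|right].
Qed.

Definition graph_field {T : Type} (G : set (T * T * T)) : set T :=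
  [set x | exists z, G (x, x, z)].

(** The graphs of the injections of [D * D] into [D], where [D] is the field of
    the graph, except that several values are allowed: injectivity alone bounds
    the cardinal of [D * D]. *)
Definition square_graph {T : Type} (G : set (T * T * T)) : Prop :=
  [/\ forall x y z, G (x, y, z) ->
        [/\ graph_field G x, graph_field G y & graph_field G z],
      forall x y, graph_field G x -> graph_field G y -> exists z, G (x, y, z)
    & forall p q z, G (p, z) -> G (q, z) -> p = q].

Lemma square_graph_le {T : Type} {G : set (T * T * T)} :
  square_graph G -> graph_field G `*` graph_field G #<= graph_field G.
Proof.
move=> [Gdom Gtot Ginj]; apply/card_le_relP.
exists (fun p z => G (p, z)); split.
  move=> [x y] [/= Dx Dy]; have [z Gz] := Gtot x y Dx Dy.
  by exists z => //; have [] := Gdom _ _ _ Gz.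
by move=> p q z _ _; exact: Ginj.
Qed.

Lemma le_square_graph {T : Type} {D : set T} : D `*` D #<= D ->
  exists2 G, square_graph G & graph_field G = D.
Proof.
move=> /card_le_relP[R [Rtot Rinj]].
exists [set w | [/\ D w.1.1, D w.1.2, D w.2 & R w.1 w.2]]; last first.
  apply/seteqP; split=> x /=; first by move=> [z [? ? ? ?]].
  by move=> Dx; have [//|z Dz Rz] := Rtot (x, x); exists z.
split.
- move=> x y z [/= Dx Dy Dz _].
  have sq w : D w -> exists v, [/\ D w, D w, D v & R (w, w) v].
    by move=> Dw; have [//|v Dv Rv] := Rtot (w, w); exists v.
  by split; exact: sq.
- move=> x y [z [/= Dx _ _ _]] [z' [/= Dy _ _ _]].
  by have [//|v Dv Rv] := Rtot (x, y); exists v.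
- by move=> p q z [/= ? ? ? Rp] [/= ? ? ? Rq]; apply: Rinj Rp Rq.
Qed.

Lemma square_graph_bigcup {T : Type} (F : set (set (T * T * T))) :
  (forall G, F G -> square_graph G) -> total_on F subset ->
  square_graph (\bigcup_(G in F) G).
Proof.
move=> Fsq Ftot.
have dir G H w v : F G -> F H -> G w -> H v ->
    exists K, [/\ F K, K w & K v].
  move=> FG FH Gw Hv; have [GH|HG] := Ftot _ _ FG FH.
    by exists H; split => //; exact: GH.
  by exists G; split => //; exact: HG.
split.
- move=> x y z [G FG Gxyz]; have [Gdom _ _] := Fsq _ FG.
  have [[u ?] [v ?] [w ?]] := Gdom _ _ _ Gxyz.
  by split; [exists u|exists v|exists w]; exists G.
- move=> x y [u [G FG Gu]] [v [H FH Hv]].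
  have [K [FK Ku Kv]] := dir _ _ _ _ FG FH Gu Hv.
  have [_ Ktot _] := Fsq _ FK.
  have [||z Kz] := Ktot x y; [by exists u|by exists v|].
  by exists z; exists K.
- move=> p q z [G FG Gp] [H FH Hq].
  have [K [FK Kp Kq]] := dir _ _ _ _ FG FH Gp Hq.
  by have [_ _ Kinj] := Fsq _ FK; exact: Kinj Kp Kq.
Qed.

(** The new pairs, those outside the square of the old field, are sent into
    [E], where no old value lies. *)
Lemma square_graph_extend {T : Type} {G : set (T * T * T)} {E : set T} :
  square_graph G -> infinite_set (graph_field G) -> graph_field G #= E ->
  graph_field G `&` E = set0 ->
  exists H, [/\ square_graph H, G `<=` H
    & graph_field H = graph_field G `|` E].
Proof.
move=> sqG; set D := graph_field G => Dinf DE DE0.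
have [Gdom Gtot Ginj] := sqG; have DD := square_graph_le sqG.
have /andP[leDE leED] : (D #<= E) && (E #<= D) by rewrite -card_eq_le.
have disj x : D x -> E x -> False.
  by move=> Dx Ex; have : (D `&` E) x by []; rewrite DE0.
have UD : D `|` E #<= D by apply: card_leU.
have UUE : (D `|` E) `*` (D `|` E) #<= E.
  apply: card_le_trans (card_leX UD UD) _.
  exact: card_le_trans DD leDE.
have /card_le_relP[R [Rtot Rinj]] := UUE.
pose new (w : T * T * T) := [/\ (D `|` E) w.1.1, (D `|` E) w.1.2,
  ~ (D w.1.1 /\ D w.1.2), E w.2 & R w.1 w.2].
have HU : graph_field (G `|` new) = D `|` E.
  apply/seteqP; split=> x; first by move=> [z [Gz|[]]//]; left; exists z.
  move=> [[z Gz]|Ex]; first by exists z; left.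
  have [|z Ez Rz] := Rtot (x, x); first by split; right.
  exists z; right; split => //; [by right|by right|].
  by move=> [Dx _]; exact: disj Dx Ex.
exists (G `|` new); split; [split; rewrite ?HU|exact: subsetUl|exact: HU].
- move=> x y z [/Gdom[Dx Dy Dz]|[/= Ux Uy _ Ez _]].
    by split; left.
  by split => //; right.
- move=> x y Ux Uy.
  have [[Dx Dy]|nDD] := pselect (D x /\ D y).
    by have [z Gz] := Gtot _ _ Dx Dy; exists z; left.
  by have [//|z Ez Rz] := Rtot (x, y); exists z; right.
- move=> p q z [Gp|[Up1 Up2 _ Ez Rp]] [Gq|[Uq1 Uq2 _ Ez' Rq]].
  + exact: Ginj Gp Gq.
  + by case: p Gp => x y /Gdom[_ _ /disj/(_ Ez')].
  + by case: q Gq => x y /Gdom[_ _ /disj/(_ Ez)].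
  + exact: Rinj Rp Rq.
Qed.

Lemma infinite_subset_nat {T : Type} {A : set T} : infinite_set A ->
  exists2 N, N `<=` A & N #= [set: nat].
Proof.
move=> /infiniteP/card_leP[f].
exists ((fun n : [set: nat] => val (f n)) @` [set: [set: nat]]).
  by move=> _ [n _ <-]; exact: set_valP.
apply: card_eq_trans (card_setT [set: nat]).
apply: inj_card_eq => m n _ _ /val_inj.
by apply: (@inj _ _ [set: [set: nat]] f); rewrite inE.
Qed.

(** Zorn's lemma is applied to the square graphs that contain a fixed countably
    infinite one. The field [D] of a maximal one satisfies [A #<= D]: otherwise
    [A `\` D] contains a copy of [D], over which the graph extends. *)
Lemma card_square {T : Type} (A : set T) : infinite_set A -> A `*` A #<= A.
Proof.
move=> Ainf; have [N NA Nnat] := infinite_subset_nat Ainf.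
have NN : N `*` N #<= N.
  have /andP[leN geN] : (N #<= [set: nat]) && ([set: nat] #<= N).
    by rewrite -card_eq_le.
  apply: card_le_trans (card_leX leN leN) _.
  apply: card_le_trans geN; rewrite setXTT.
  by move: card_nat2; rewrite card_eq_le => /andP[].
have [G0 sqG0 G0N] := le_square_graph NN.
(* the union with G0 makes the empty chain harmless *)
pose Q F := square_graph (G0 `|` F) /\ graph_field (G0 `|` F) `<=` A.
have [F FQ Ftot|F [[sqF FA] Fmax]] := @Zorn_bigcup _ Q.
  have [[F0 FF0]|noF] := pselect (exists F0, F F0); last first.
    have -> : \bigcup_(X in F) X = set0.
      by apply/seteqP; split => // w [X FX]; case: noF; exists X.
    by rewrite /Q setU0 G0N.
  have E : G0 `|` \bigcup_(X in F) X =
      \bigcup_(G in [set G0 `|` X | X in F]) G.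
    apply/seteqP; split=> w.
      move=> [G0w|[X FX Xw]]; first by exists (G0 `|` F0); [exists F0|left].
      by exists (G0 `|` X); [exists X|right].
    move=> [_ [X FX <-]] [G0w|Xw]; first by left.
    by right; exists X.
  rewrite /Q E; split.
    apply: square_graph_bigcup; first by move=> _ [X FX <-]; case: (FQ _ FX).
    move=> _ _ [X FX <-] [Y FY <-].
    by have [XY|YX] := Ftot _ _ FX FY; [left|right]; exact: setUS.
  move=> x [z [_ [X FX <-] w]]; have [_] := FQ _ FX.
  by apply; exists z.
set G := G0 `|` F in sqF FA.
pose D := graph_field G.
have Dinf : infinite_set D.
  apply: (@sub_infinite_set _ N); last first.
    by rewrite (eq_finite_set Nnat); exact: infinite_nat.
  by rewrite -G0N => x [z G0z]; exists z; left.
have DD : D `*` D #<= D := square_graph_le sqF.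
have AD : A #<= D.
  have [/card_leP[f]|ADD] := card_le_total D (A `\` D); last first.
    rewrite -(setDUK FA); apply: card_leU => //; exact: card_lexx.
  exfalso.
  pose g (x : D) : T := val (f x).
  pose E := g @` [set: D].
  have EAD : E `<=` A `\` D by move=> _ [x _ <-]; exact: set_valP.
  have DE : D #= E.
    apply: card_eq_trans (card_setT_sym D) _; rewrite card_eq_sym.
    apply: inj_card_eq => a b _ _ /val_inj.
    by apply: (@inj _ _ [set: D] f); rewrite inE.
  have DE0 : D `&` E = set0.
    by apply/seteqP; split => // x [Dx /EAD[]].
  have [H [sqH GH HDE]] := square_graph_extend sqF Dinf DE DE0.
  have [x Dx] := infinite_setN0 Dinf.
  have Egx : E (g (SigSub (mem_set Dx))) by exists (SigSub (mem_set Dx)).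
  have G0H : G0 `|` H = H by apply/setUidPr => w G0w; apply: GH; left.
  apply: (Fmax H).
    split=> [w Fw|HF]; first by apply: GH; right.
    have [_] := EAD _ Egx; apply.
    have [z /HF Fz] : graph_field H (g (SigSub (mem_set Dx))).
      by rewrite HDE; right.
    by exists z; right.
  split; rewrite G0H // HDE => y [/FA//|/EAD[]//].
apply: card_le_trans (card_leX AD AD) _.
by apply: card_le_trans DD _; exact: subset_card_le.
Qed.

(** * Convex neighbourhoods and crowded orders *)

Section OrderTopology.
Context {d : Order.disp_t} {X : orderTopologicalType d}.
Implicit Types (x y z a b c e : X) (U V B D : set X) (K : set (set X)).

Lemma nbhs_order_convex x U : nbhs x U ->
  exists V, [/\ open V, V x, V `<=` U
    & forall a b c, V a -> V b -> (a <= c <= b)%O -> V c].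
Proof.
rewrite itv_nbhsE => -[i [io xi] iU].
exists [set` i]; split => //; first exact: itv_open_ends_open.
move=> a b c; case: i {io xi iU} => l r /=.
rewrite !itv_boundlr => /andP[la _] /andP[_ br] /andP[ac cb].
apply/andP; split.
  by apply: le_trans la _; rewrite bnd_simp.
by apply: le_trans br; rewrite bnd_simp.
Qed.

Lemma discrete_subset_isolated D x : discrete_subset D -> D x ->
  exists2 U, nbhs x U & forall y, U y -> D y -> y = x.
Proof.
move=> Ddiscr Dx; pose x' : D := SigSub (mem_set Dx).
have [U oU Ux'] := Ddiscr [set x'].
have memU (y : D) : U (val y) = (y = x').
  by rewrite -[U _]/((val @^-1` U) y) Ux'.
exists U; first by apply: open_nbhs_nbhs; split => //; rewrite -[x]/(val x') memU.
move=> y Uy Dy; have : U (val (SigSub (mem_set Dy) : D)) by [].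
by rewrite memU => /(congr1 val).
Qed.

Lemma open_setD_finite U V : open U -> finite_set V -> open (U `\` V).
Proof.
move=> oU Vfin; apply: openI => //; apply: closed_openC.
have /accessible_finite_set_closed := hausdorff_accessible (@order_hausdorff d X).
exact.
Qed.

Section Crowded.
Hypothesis crowded : forall x, ~ open [set x].

Lemma crowded_infinite U : open U -> U !=set0 -> infinite_set U.
Proof.
move=> oU [x Ux] Ufin; apply: (crowded x).
have -> : [set x] = U `\` (U `\ x).
  apply/seteqP; split=> [_ ->|y [Uy nUy]]; first by split => // -[_]; apply.
  by apply: contrapT => yx; apply: nUy.
by apply: open_setD_finite => //; exact: finite_setD.
Qed.

(** A convex open set inside [U] contains three points; the middle one shows that
    the interval between the other two is not empty. *)
Lemma crowded_itv U : open U -> U !=set0 ->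
  exists a b, `]a, b[ !=set0 /\ `[a, b] `<=` U.
Proof.
move=> oU [x Ux]; have nU : nbhs x U by exact: open_nbhs_nbhs.
have [V [oV Vx VU Vconv]] := nbhs_order_convex _ _ nU.
have Vinf : infinite_set V by apply: crowded_infinite => //; exists x.
have [y [Vy yx]] : V `\ x !=set0.
  by apply: infinite_setN0; apply: infinite_setD => //; exact: finite_set1.
have [z [Vz zxy]] : V `\` [set x; y] !=set0.
  by apply: infinite_setN0; apply: infinite_setD => //; exact: finite_set2.
have itvV a c b : V a -> V b -> (a < c)%O -> (c < b)%O ->
    exists a b, `]a, b[ !=set0 /\ `[a, b] `<=` U.
  move=> Va Vb ac cb; exists a, b; split.
    by exists c; rewrite /= in_itv /= ac.
  move=> w; rewrite /= in_itv /= => aw; apply: VU; exact: Vconv aw.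
have three u v : V u -> V v -> (u < v)%O -> ~ [set u; v] z ->
    exists a b, `]a, b[ !=set0 /\ `[a, b] `<=` U.
  move=> Vu Vv uv zuv; have [zu|uz|zu] := ltgtP z u.
  - exact: (itvV z u v).
  - have [zv|vz|zv] := ltgtP z v.
    + exact: (itvV u z v).
    + exact: (itvV u v z).
    + by case: zuv; right.
  - by case: zuv; left.
have [xy|yx'|xy] := ltgtP x y; last by case: yx.
  exact: (three x y).
by apply: (three y x) => //; rewrite setUC.
Qed.

(** * First points of the members of a cover *)

(** With the reversed order for [r], these are the last points of the members of
    [K] up to [e]. *)
Definition first_points (r : rel X) K e : set X :=
  [set x | exists2 B, K B &
    [/\ B x, r e x & forall y, B y -> r e y -> r x y]].

Lemma card_first_points (r : rel X) K e : antisymmetric r ->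
  first_points r K e #<= K.
Proof.
move=> r_anti; apply/card_le_relP.
exists (fun x B => [/\ B x, r e x & forall y, B y -> r e y -> r x y]); split.
  by move=> x [B KB Bx]; exists B.
move=> x x' B _ _ [Bx ex xmin] [Bx' ex' x'min].
by apply: r_anti; rewrite xmin // x'min.
Qed.

Lemma card_bigcup_first_points (r : rel X) K V : antisymmetric r ->
  \bigcup_(e in V) first_points r K e #<= V `*` K.
Proof.
move=> r_anti; apply/card_le_relP.
exists (fun x q =>
  [/\ q.2 x, r q.1 x & forall y, q.2 y -> r q.1 y -> r x y]); split.
  by move=> x [e Ve [B KB Bx]]; exists (e, B).
move=> x x' [e B] _ _ [Bx ex xmin] [Bx' ex' x'min].
by apply: r_anti; rewrite xmin // x'min.
Qed.

(** Were this false, nested intervals could avoid all the first points, and a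
    cluster point of their left ends would belong to no member of [K]. *)
Lemma first_points_dense_itv K : compact [set: X] -> [set: X] !=set0 ->
  (forall B, K B -> discrete_subset B) -> \bigcup_(B in K) B = [set: X] ->
  exists a b, `]a, b[ !=set0 /\
    forall V, open V -> V !=set0 -> V `<=` `]a, b[ ->
      V `&` first_points <=%O K a !=set0.
Proof.
move=> cptX X0 discrK covK; apply: contrapT => nodense.
pose fat := {p : X * X | `]p.1, p.2[ !=set0}.
pose next (p q : fat) := [/\ ((sval p).1 < (sval q).1)%O,
  ((sval q).2 <= (sval p).2)%O &
  forall x, first_points <=%O K (sval p).1 x ->
    ~ `[(sval q).1, (sval q).2]%classic x].
have ex_next (p : fat) : {q : fat | next p q}.
  apply: cid; case: p => -[a b] /= ab0.
  have [V [oV V0 Vab VK]] : exists V, [/\ open V, V !=set0, V `<=` `]a, b[ &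
      V `&` first_points <=%O K a = set0].
    apply: contrapT => noV; apply: nodense; exists a, b; split => // V oV V0 Vab.
    by apply/set0P/eqP => VK; apply: noV; exists V.
  have [a' [b' [ab'0 ab'V]]] := crowded_itv _ oV V0.
  have [c /=] := ab'0; rewrite in_itv /= => /andP[a'c cb'].
  have a'b' : (a' <= b')%O by rewrite ltW // (lt_trans a'c).
  exists (exist _ (a', b') ab'0); split => /=.
  - have /ab'V/Vab : `[a', b'] a' by rewrite /= in_itv /= lexx.
    by rewrite /= in_itv /= => /andP[].
  - have /ab'V/Vab : `[a', b'] b' by rewrite /= in_itv /= lexx andbT.
    by rewrite /= in_itv /= => /andP[_ /ltW].
  - move=> x xK xab.
    suff : (V `&` first_points <=%O K a) x by rewrite VK.
    by split => //; exact: ab'V.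
have [a0 [b0 [ab0 _]]] := crowded_itv _ openT X0.
have [p [_ pS]] := dependent_choice ex_next (exist _ (a0, b0) ab0).
pose a n := (sval (p n)).1; pose b n := (sval (p n)).2.
have a_lt n : (a n < a n.+1)%O by have [] := pS n.
have b_le n : (b n.+1 <= b n)%O by have [] := pS n.
have ab n : (a n < b n)%O.
  rewrite /a /b; case: (p n) => q [c] /=; rewrite in_itv /= => /andP[].
  exact: lt_trans.
have a_mono m n : (m <= n)%N -> (a m <= a n)%O.
  by move=> /subnK <-; elim: (n - m)%N => // k /le_trans; apply; exact/ltW.
have b_mono m n : (m <= n)%N -> (b n <= b m)%O.
  by move=> /subnK <-; elim: (n - m)%N => // k; apply: le_trans; exact: b_le.
have ab_le m n : (a m <= b n)%O.
  apply: (@le_trans _ _ (a (maxn m n))); first by rewrite a_mono ?leq_maxl.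
  apply: (@le_trans _ _ (b (maxn m n))); first exact/ltW.
  by rewrite b_mono ?leq_maxr.
have [x [_ clx]] : [set: X] `&` cluster (a @ \oo) !=set0.
  by apply: cptX; exact: filterT.
have a_freq U : nbhs x U -> forall m, exists2 n, (m <= n)%N & U (a n).
  move=> Ux m.
  have /clx : (a @ \oo) [set a n | n in [set n | (m <= n)%N]].
    by exists m => // n mn; exists n.
  by move=> /(_ _ Ux)[_ [[n mn <-] Uan]]; exists n.
have ax n : (a n <= x)%O.
  rewrite leNgt; apply/negP => xan.
  have [|k nk] := a_freq `]-oo, a n[ _ n.
    by apply: open_nbhs_nbhs; split => //; rewrite /= in_itv.
  by rewrite /= in_itv /= ltNge a_mono.
have xb n : (x <= b n)%O.
  rewrite leNgt; apply/negP => bnx.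
  have [|k nk] := a_freq `]b n, +oo[ _ n.
    by apply: open_nbhs_nbhs; split => //; rewrite /= in_itv /= bnx.
  by rewrite /= in_itv /= andbT ltNge ab_le.
(* the points [a n] reach the neighbourhood of [x] that isolates it in [B] *)
have [B KB Bx] : (\bigcup_(B in K) B) x by rewrite covK.
have [U Ux UB] := discrete_subset_isolated _ _ (discrK _ KB) Bx.
have [V [oV Vx VU Vconv]] := nbhs_order_convex _ _ Ux.
have [n _ Van] := a_freq V (open_nbhs_nbhs (conj oV Vx)) 0%N.
have [_ _ /(_ x)] := pS n; apply; last by rewrite /= in_itv /= ax xb.
exists B => //; split => [//||y By ay]; first exact: ax.
have [//|yx] := leP x y.
have yV : V y by apply: (Vconv (a n) x) => //; rewrite ay ltW.
by rewrite (UB y (VU _ yV) By) ltxx in yx.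
Qed.

(** Density gives a point [e] of [E], other than [x], in a convex neighbourhood
    that isolates [x] in a member [B] of [K]; then [x] is next to [e] in [B]. *)
Lemma open_sub_first_points K V (E : set X) :
  (forall B, K B -> discrete_subset B) -> \bigcup_(B in K) B = [set: X] ->
  open V ->
  (forall W, open W -> W !=set0 -> W `<=` V -> W `&` E !=set0) ->
  V `<=` \bigcup_(e in E) first_points <=%O K e `|`
         \bigcup_(e in E) first_points >=%O K e.
Proof.
move=> discrK covK oV Edense x Vx.
have [B KB Bx] : (\bigcup_(B in K) B) x by rewrite covK.
have [U Ux UB] := discrete_subset_isolated _ _ (discrK _ KB) Bx.
have [W [oW Wx WU Wconv]] := nbhs_order_convex _ _ Ux.
have oWV : open (W `&` V) by exact: openI.
have [|||e [[[We Ve] ex] Ee]] := Edense ((W `&` V) `\ x).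
- by apply: open_setD_finite => //; exact: finite_set1.
- apply: infinite_setN0; apply: infinite_setD; last exact: finite_set1.
  by apply: crowded_infinite => //; exists x.
- by move=> y [[]].
have [ltex|ltxe|//] := ltgtP e x.
- left; exists e => //; exists B => //; split; [by []|exact: ltW|] => y By ey.
  have [//|yx] := leP x y.
  have yW : W y by apply: (Wconv e x) => //; rewrite ey ltW.
  by rewrite (UB y (WU _ yW) By) ltxx in yx.
- right; exists e => //; exists B => //; split; [by []|exact: ltW|] => y By /= ye.
  have [//|xy] := leP y x.
  have yW : W y by apply: (Wconv x e) => //; rewrite ye ltW.
  by rewrite (UB y (WU _ yW) By) ltxx in xy.
Qed.

(** The open set is an interval in which the first points are dense; it is
    covered by two sets of at most [|K| * |K|] points each. *)
Lemma small_open_of_discrete_cover K : compact [set: X] -> [set: X] !=set0 ->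
  (forall B, K B -> discrete_subset B) -> \bigcup_(B in K) B = [set: X] ->
  exists V, [/\ open V, V !=set0 & V #<= K].
Proof.
move=> cptX X0 discrK covK.
have [a [b [ab0 dense]]] := first_points_dense_itv _ cptX X0 discrK covK.
exists `]a, b[%classic; split => //.
set E := first_points <=%O K a in dense.
have EK : E #<= K by apply: card_first_points; exact: le_anti.
have sub := open_sub_first_points _ _ _ discrK covK (itv_open a b) dense.
have leEK (r : rel X) : antisymmetric r ->
    \bigcup_(e in E) first_points r K e #<= K `*` K.
  move=> r_anti; apply: card_le_trans (card_bigcup_first_points _ _ _ r_anti) _.
  by apply: card_leX => //; exact: card_lexx.
have le1 := leEK _ (@le_anti _ X); have le2 := leEK _ (@ge_anti _ X).
apply: card_le_trans (subset_card_le sub) _.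
have Kinf : infinite_set K.
  move=> Kfin; apply: (crowded_infinite _ (itv_open a b) ab0).
  apply: sub_finite_set sub _; rewrite finite_setU; split.
    by apply: card_le_finite le1 _; exact: finite_setX.
  by apply: card_le_finite le2 _; exact: finite_setX.
have KK := card_square _ Kinf.
by apply: card_leU => //; [apply: card_le_trans le1 _|apply: card_le_trans le2 _].
Qed.

End Crowded.

End OrderTopology.

(** * The discrete covering number of a compact order *)

Theorem corollary2p6 (d : Order.disp_t) (X : orderTopologicalType d)
    (X_nonempty : [set: X] !=set0) (X_compact : compact [set: X]) :
  dis X #>= Delta X.
Proof.
have [disX covX _] := disP X; have [_ _ Delta_min] := DeltaP X_nonempty.
have [[x ox]|crowded] := pselect (exists x : X, open [set x]).
  apply: card_le_trans (Delta_min _ ox _) _; first by exists x.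
  have [y _] := X_nonempty.
  have [B dB _] : (\bigcup_(B in dis X) B) y by rewrite covX.
  apply: (@card_le_trans _ _ _ [set B]); last by apply: subset_card_le => _ ->.
  by have := eq_card1 x B; rewrite card_eq_le => /andP[].
have [|V [oV V0 VK]] :=
    @small_open_of_discrete_cover d X _ (dis X) X_compact X_nonempty disX covX.
  by move=> x ox; apply: crowded; exists x.
exact: card_le_trans (Delta_min _ oV V0) VK.
Qed.
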